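(* Let $d\ge 1$ be an integer and let $\alpha\in(0,d)$. For any finite sets $A,B\subset\mathbb{Z}^d$, $$\lim_{\|z\|\to\infty}\frac{\mathrm{Cap}_\alpha(A)+\mathrm{Cap}_\alpha(B)-\mathrm{Cap}_\alpha(A\cup(z+B))}{g_\alpha(z)} = 2\cdot \mathrm{Cap}_\alpha(A)\cdot\mathrm{Cap}_\alpha(B),$$ where $z$ ranges over $\mathbb{Z}^d$, $g_\alpha(z)=(1+\|z\|)^{-\alpha}$, and $\mathrm{Cap}_\alpha$ denotes the Bessel-Riesz capacity of index $\alpha$.
   Context: $\|\cdot\|$ is the Euclidean norm and $z+B=\{z+b:b\in B\}$. For $\alpha\in(0,d)$ and a finite set $A\subset\mathbb{Z}^d$, the Bessel-Riesz capacity is $$\mathrm{Cap}_\alpha(A)=\Big(\inf\Big\{\sum_{x,y\in A}g_\alpha(y-x)\,\mu(x)\mu(y)\;:\;\mu\text{ a probability measure on }A\Big\}\Big)^{-1},\qquad g_\alpha(z)=(1+\|z\|)^{-\alpha},$$ with the convention $\mathrm{Cap}_\alpha(\emptyset)=0$ (infimum over the empty set equal to $+\infty$). *)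

(* Defs.v *)
(* Libraries: MathComp, finmap and MathComp-Analysis. *)
From HB Require Import structures.
From mathcomp Require Import all_boot all_order all_algebra finmap.
From mathcomp Require Import all_classical all_reals all_analysis.

Set Implicit Arguments.
Unset Strict Implicit.
Unset Printing Implicit Defensive.

Import Order.TTheory GRing.Theory Num.Theory.
Import numFieldNormedType.Exports.

Local Open Scope classical_set_scope.
Local Open Scope ring_scope.

(* The lattice Z^d is the type 'rV[int]_d of integer row vectors. *)

Section BesselRieszCapacity.
Variables (R : realType) (d : nat).
Implicit Types (z : 'rV[int]_d) (A B : {fset 'rV[int]_d}).

(* The norm carried by matrices in MathComp-Analysis is the sup norm. *)
Definition euclidean_norm z : R :=
  Num.sqrt (\sum_(i < d) ((z ord0 i)%:~R) ^+ 2).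

Definition riesz_kernel (alpha : R) z : R :=
  (1 + euclidean_norm z) `^ (- alpha).

(* Probability measures on a finite set are given by their mass functions,
   extended by 0 to the whole lattice. *)
Definition probability_on A (mu : 'rV[int]_d -> R) : Prop :=
  [/\ forall x, 0 <= mu x,
      forall x, x \notin A -> mu x = 0
    & \sum_(x <- A) mu x = 1].

Definition riesz_energy (alpha : R) A (mu : 'rV[int]_d -> R) : R :=
  \sum_(x <- A) \sum_(y <- A) riesz_kernel alpha (y - x) * mu x * mu y.

(* The infimum and the inverse are taken in the extended reals, where
   ereal_inf set0 = +oo and +oo^-1 = 0; see capacity0 for the empty set.
   The projection fine loses nothing, see ereal_capacity_fin_num. *)
Definition ereal_capacity (alpha : R) A : \bar R :=
  ((ereal_inf [set (riesz_energy alpha A mu)%:E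
              | mu in probability_on A])^-1)%E.

Definition capacity (alpha : R) A : R := fine (ereal_capacity alpha A).

Definition translate z B : {fset 'rV[int]_d} := [fset (z + b)%R | b in B]%fset.

(* The filter on Z^d describing "||z|| tends to infinity". *)
Definition norm_infty : set_system 'rV[int]_d :=
  filter_from [set: R] (fun M => [set z | M < euclidean_norm z]).

#[global] Instance norm_infty_filter : Filter norm_infty.
Proof.
apply: filter_from_filter; first by exists 0.
move=> M N _ _; exists (Num.max M N) => // z /=.
by rewrite gt_max => /andP[].
Qed.

Lemma norm_infty_proper : (0 < d)%N -> ProperFilter norm_infty.
Proof.
move=> d_gt0; apply: filter_from_proper => M _.
exists (const_mx (Num.truncn `|M|).+1%:Z) => /=.
rewrite (le_lt_trans (ler_norm M))// (lt_le_trans (truncnS_gt _))//.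
rewrite /euclidean_norm -[leLHS]ger0_norm ?ler0n// -sqrtr_sqr ler_sqrt; last first.
  by apply: sumr_ge0 => i _; exact: sqr_ge0.
rewrite (bigD1 (Ordinal d_gt0))//= mxE lerDl.
by apply: sumr_ge0 => i _; exact: sqr_ge0.
Qed.

Lemma capacity0 (alpha : R) : capacity alpha fset0 = 0.
Proof.
rewrite /capacity /ereal_capacity (_ : [set _ | _ in _] = set0).
  by rewrite ereal_inf0.
rewrite -subset0 => r [mu [_ _ mu1] _]; move/eqP: mu1.
by rewrite big_seq_fset0 eq_sym oner_eq0.
Qed.

Lemma ereal_capacity_fin_num (alpha : R) A :
  0 < alpha -> ereal_capacity alpha A \is a fin_num.
Proof.
move=> alpha_gt0.
have norm_ge0 z : 0 <= euclidean_norm z by exact: sqrtr_ge0.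
pose S : R := \sum_(x <- A) \sum_(y <- A) euclidean_norm (y - x).
have S_ge0 : 0 <= S by apply: sumr_ge0 => x _; apply: sumr_ge0.
pose c := (1 + S) `^ (- alpha).
have c_gt0 : 0 < c by rewrite powR_gt0// ltr_pwDl.
have c_le x y : x \in A -> y \in A -> c <= riesz_kernel alpha (y - x).
  move=> xA yA; rewrite /riesz_kernel /c !powRN lef_pV2 ?posrE ?powR_gt0 ?ltr_pwDl//.
  rewrite ge0_ler_powR ?nnegrE ?addr_ge0 ?(ltW alpha_gt0)// lerD2l.
  rewrite /S (big_fsetD1 x)//= (big_fsetD1 y)//= -addrA lerDl.
  by rewrite addr_ge0 ?sumr_ge0// => u _; apply: sumr_ge0.
set I := ereal_inf [set (riesz_energy alpha A mu)%:E | mu in probability_on A].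
have c_leI : (c%:E <= I)%E.
  apply: le_ereal_inf_tmp => _ [mu [mu_ge0 _ mu1] <-]; rewrite lee_fin.
  rewrite -[leLHS]mulr1 -{1}[1]mulr1 -{1}mu1 -mu1 mulr_suml mulr_sumr.
  rewrite /riesz_energy big_seq [leRHS]big_seq; apply: ler_sum => x xA.
  rewrite mulr_sumr mulr_sumr big_seq [leRHS]big_seq; apply: ler_sum => y yA.
  by rewrite -[leRHS]mulrA ler_wpM2r ?mulr_ge0 ?c_le.
rewrite /ereal_capacity -/I; case: I c_leI => [r||]//=; rewrite lee_fin => cr.
by rewrite /inve gt_eqF// (lt_le_trans c_gt0).
Qed.

End BesselRieszCapacity.

Arguments norm_infty : clear implicits.

(* Main.v *)
Require Import Defs.
From HB Require Import structures.
From mathcomp Require Import all_boot all_order all_algebra finmap.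
From mathcomp Require Import all_classical all_reals all_analysis.
From mathcomp Require Import ring lra.

Set Implicit Arguments.
Unset Strict Implicit.
Unset Printing Implicit Defensive.

Import Order.TTheory GRing.Theory Num.Theory.
Import numFieldNormedType.Exports.

Local Open Scope classical_set_scope.
Local Open Scope ring_scope.

(* [cap A] is the best constant [C] in [(sum of mu)^2 <= C * energy mu] for
   nonnegative [mu] on [A]. When [z] is large, [A] and [z + B] are disjoint and
   their mutual energy is [g z * (1 + o(1))] times the product of the masses,
   so optimizing the distribution of the total mass between the two sets yields
   [cap (A u (z + B)) = (p + q - 2 h p q) / (1 - h^2 p q)] with [p = cap A],
   [q = cap B] and [h = g z * (1 + o(1))]; expand at [h = 0]. *)

(** * Finite sums *)

(** Lagrange's identity: the double sum of the squares of [u i * v j - u j * v i] is twice the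
    difference of the two sides. *)
Lemma sum_CauchySchwarz (R : realDomainType) (I : finType) (u v : I -> R) :
  (\sum_i u i * v i) ^+ 2 <= (\sum_i u i ^+ 2) * (\sum_i v i ^+ 2).
Proof.
have : 0 <= \sum_i \sum_j (u i * v j - u j * v i) ^+ 2.
  by apply: sumr_ge0 => i _; apply: sumr_ge0 => j _; exact: sqr_ge0.
have -> : \sum_i \sum_j (u i * v j - u j * v i) ^+ 2 =
    \sum_i \sum_j u i ^+ 2 * v j ^+ 2 + \sum_i \sum_j u j ^+ 2 * v i ^+ 2
    - 2 * \sum_i \sum_j (u i * v i) * (u j * v j).
  rewrite mulr_sumr -big_split -sumrB; apply: eq_bigr => i _ /=.
  by rewrite mulr_sumr -big_split -sumrB; apply: eq_bigr => j _ /=; ring.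
rewrite [X in _ + X - _]exchange_big -!big_distrlr /= -expr2.
by set s := _ ^+ 2; set t := _ * _; lra.
Qed.

Lemma sum_fsetU_disjoint (V : nmodType) (T : choiceType) (A B : {fset T})
    (F : T -> V) : [disjoint A & B]%fset ->
  \sum_(x <- (A `|` B)%fset) F x = \sum_(x <- A) F x + \sum_(x <- B) F x.
Proof.
move=> /fdisjointP AB; rewrite -big_cat; apply/perm_big/uniq_perm => //.
  rewrite cat_uniq !fset_uniq andbT; apply/hasPn => x xB; apply/negP => xA.
  by move: (AB _ xA); rewrite xB.
by move=> x; rewrite mem_cat inE.
Qed.

(** * The Euclidean norm on the lattice *)

Section EuclideanNorm.
Variables (R : realType) (d : nat).
Implicit Types x y z : 'rV[int]_d.
Local Notation norm := (euclidean_norm R).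

Lemma euclidean_norm_ge0 x : 0 <= norm x. Proof. exact: sqrtr_ge0. Qed.

Lemma euclidean_normN x : norm (- x) = norm x.
Proof.
by congr Num.sqrt; apply: eq_bigr => i _; rewrite mxE rmorphN sqrrN.
Qed.

Lemma euclidean_normD x y : norm (x + y) <= norm x + norm y.
Proof.
have S_ge0 z : 0 <= \sum_(i < d) ((z ord0 i)%:~R : R) ^+ 2.
  by apply: sumr_ge0 => i _; exact: sqr_ge0.
have normS z : norm z ^+ 2 = \sum_(i < d) ((z ord0 i)%:~R : R) ^+ 2.
  exact: sqr_sqrtr.
rewrite -(@ler_pXn2r _ 2) ?nnegrE ?addr_ge0 ?euclidean_norm_ge0//.
rewrite sqrrD !normS.
have -> : \sum_(i < d) (((x + y) ord0 i)%:~R : R) ^+ 2 =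
   \sum_(i < d) ((x ord0 i)%:~R : R) ^+ 2
   + (\sum_(i < d) ((x ord0 i)%:~R : R) * (y ord0 i)%:~R) *+ 2
   + \sum_(i < d) ((y ord0 i)%:~R : R) ^+ 2.
  rewrite -sumrMnl -!big_split; apply: eq_bigr => i _ /=.
  by rewrite mxE rmorphD sqrrD.
rewrite lerD2r lerD2l lerMn2r /= (le_trans (ler_norm _))//.
rewrite -(@ler_pXn2r _ 2) ?nnegrE ?mulr_ge0 ?euclidean_norm_ge0//.
by rewrite exprMn !normS -normrX ger0_norm ?sqr_ge0// sum_CauchySchwarz.
Qed.

End EuclideanNorm.

(* The inverse of the minimum over [t] of
   [t ^+ 2 / p + (1 - t) ^+ 2 / q + 2 * t * (1 - t) * h]. The minimizer gives the
   two sets masses proportional to [p * (1 - h * q)] and [q * (1 - h * p)]. *)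
Definition coupled_capacity (R : realType) (p q h : R) : R :=
  (p + q - 2 * h * p * q) / (1 - h ^+ 2 * p * q).

(** * Optimal sharing of mass between two sets *)

Section CoupledCapacity.
Variables (R : realType) (p q h : R).
Hypotheses (p_ge0 : 0 <= p) (q_ge0 : 0 <= q) (h_ge0 : 0 <= h).
Hypotheses (hp_lt1 : h * p < 1) (hq_lt1 : h * q < 1).

Lemma coupled_numerator_ge0 : 0 <= p + q - 2 * h * p * q.
Proof.
have -> : p + q - 2 * h * p * q = p * (1 - h * q) + q * (1 - h * p) by ring.
by rewrite addr_ge0// mulr_ge0// subr_ge0 ltW.
Qed.

Lemma coupled_denominator_gt0 : 0 < 1 - h ^+ 2 * p * q.
Proof.
have -> : h ^+ 2 * p * q = (h * p) * (h * q) by ring.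
by rewrite subr_gt0 mulr_ilt1// mulr_ge0.
Qed.

Lemma coupled_capacity_ge0 : 0 <= coupled_capacity p q h.
Proof. by rewrite divr_ge0 ?coupled_numerator_ge0// ltW ?coupled_denominator_gt0. Qed.

(** Here [m], [n] stand for the masses of the two sets and [x], [y] for their self-energies. Once
    [x], [y] are replaced by the lower bounds [m ^+ 2 / p], [n ^+ 2 / q] and the denominator is
    cleared, the two sides differ by [p * q] times a square, which vanishes at the optimal ratio of
    masses. *)
Lemma sqr_mass_le_coupled (m n x y : R) : 0 <= x -> 0 <= y ->
    m ^+ 2 <= p * x -> n ^+ 2 <= q * y ->
  (m + n) ^+ 2 <= coupled_capacity p q h * (x + y + 2 * h * m * n).
Proof.
move=> x_ge0 y_ge0 mx ny; have S_ge0 := coupled_numerator_ge0.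
have D_gt0 := coupled_denominator_gt0.
rewrite /coupled_capacity mulrAC ler_pdivlMr//.
(* The bounds used below divide by [p] and [q]. A zero value, as for an empty set, forces the
   corresponding mass to vanish. *)
have [p0|p_neq0] := eqVneq p 0.
  have m0 : m = 0.
    by apply/eqP; rewrite -sqrf_eq0 eq_le sqr_ge0 andbT -(mul0r x) -p0.
  rewrite m0 p0 !(mulr0, mul0r, subr0, add0r, addr0, mulr1) (le_trans ny)//.
  by rewrite ler_wpM2l// lerDr.
have [q0|q_neq0] := eqVneq q 0.
  have n0 : n = 0.
    by apply/eqP; rewrite -sqrf_eq0 eq_le sqr_ge0 andbT -(mul0r y) -q0.
  rewrite n0 q0 !(mulr0, mul0r, subr0, add0r, addr0, mulr1) (le_trans mx)//.
  by rewrite ler_wpM2l// lerDl.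
have p_gt0 : 0 < p by rewrite lt_neqAle eq_sym p_neq0.
have q_gt0 : 0 < q by rewrite lt_neqAle eq_sym q_neq0.
apply: (@le_trans _ _ ((p + q - 2 * h * p * q) *
    (m ^+ 2 / p + n ^+ 2 / q + 2 * h * m * n))).
  rewrite -subr_ge0.
  have -> : (p + q - 2 * h * p * q) * (m ^+ 2 / p + n ^+ 2 / q + 2 * h * m * n)
      - (m + n) ^+ 2 * (1 - h ^+ 2 * p * q)
      = p * q * (m * (p^-1 - h) - n * (q^-1 - h)) ^+ 2.
    by field; rewrite p_neq0 q_neq0.
  by rewrite mulr_ge0 ?sqr_ge0// mulr_ge0.
rewrite ler_wpM2l// lerD2r lerD//.
  by rewrite ler_pdivrMr// mulrC.
by rewrite ler_pdivrMr// mulrC.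
Qed.

End CoupledCapacity.

Section Capacity.
Variables (R : realType) (d : nat) (alpha : R).
Hypothesis alpha_gt0 : 0 < alpha.
Implicit Types (x y z w : 'rV[int]_d) (A B : {fset 'rV[int]_d}).
Implicit Types (mu nu : 'rV[int]_d -> R) (C h e : R).
Local Notation norm := (euclidean_norm R).
Local Notation g := (riesz_kernel alpha).
Local Notation energy := (riesz_energy alpha).
Local Notation cap := (capacity alpha).

(** * The kernel under a bounded shift *)

Lemma riesz_kernel_gt0 z : 0 < g z.
Proof. by rewrite powR_gt0// ltr_pwDl// euclidean_norm_ge0. Qed.

Lemma riesz_kernelN z : g (- z) = g z.
Proof. by rewrite /riesz_kernel euclidean_normN. Qed.

Lemma ge0_powRN_le (s t : R) : 0 < s -> s <= t -> t `^ (- alpha) <= s `^ (- alpha).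
Proof.
move=> s_gt0 st; have t_gt0 := lt_le_trans s_gt0 st.
rewrite !powRN lef_pV2 ?posrE ?powR_gt0// ge0_ler_powR ?nnegrE//.
all: exact: ltW.
Qed.

(** The triangle inequality bounds [1 + norm (z + w)] below by [1 + norm z - rho], which is
    positive. Factoring out [1 + norm z] isolates [g z] and leaves a correction that tends to 1 as
    [z] goes to infinity. *)
Lemma riesz_kernelD_le z w (rho : R) : norm w <= rho -> rho < 1 + norm z ->
  g (z + w) <= g z * (1 - rho / (1 + norm z)) `^ (- alpha).
Proof.
move=> w_rho rho_z; have nz_gt0 : 0 < 1 + norm z.
  by rewrite ltr_pwDl// euclidean_norm_ge0.
rewrite /riesz_kernel -powRM ?subr_ge0 ?ler_pdivrMr ?mul1r ?(ltW rho_z)//;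
  last exact: ltW.
rewrite mulrBr mulr1 mulrC divfK ?gt_eqF//.
apply: ge0_powRN_le; first by rewrite subr_gt0.
have := euclidean_normD R (z + w) (- w).
by rewrite addrK euclidean_normN; lra.
Qed.

Lemma riesz_kernelD_ge z w (rho : R) : norm w <= rho ->
  g z * (1 + rho / (1 + norm z)) `^ (- alpha) <= g (z + w).
Proof.
move=> w_rho; have nz_gt0 : 0 < 1 + norm z.
  by rewrite ltr_pwDl// euclidean_norm_ge0.
have rho_ge0 : 0 <= rho by rewrite (le_trans (euclidean_norm_ge0 _ w)).
rewrite /riesz_kernel -powRM ?addr_ge0 ?divr_ge0 ?euclidean_norm_ge0//;
  last exact: ltW.
rewrite mulrDr mulr1 mulrC divfK ?gt_eqF//.
apply: ge0_powRN_le; first by rewrite ltr_pwDl// euclidean_norm_ge0.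
by have := euclidean_normD R z w; lra.
Qed.

(** * Energy of finite sets *)

Lemma riesz_energy_ge0 A mu : (forall x, 0 <= mu x) -> 0 <= energy A mu.
Proof.
move=> mu_ge0; apply: sumr_ge0 => x _; apply: sumr_ge0 => y _.
by rewrite !mulr_ge0// ltW// riesz_kernel_gt0.
Qed.

Lemma eq_riesz_energy A mu nu : {in A, mu =1 nu} -> energy A mu = energy A nu.
Proof.
move=> eq_mu; apply: eq_big_seq => x xA; apply: eq_big_seq => y yA.
by rewrite !eq_mu.
Qed.

Lemma riesz_energyZ A C mu : energy A (fun x => C * mu x) = C ^+ 2 * energy A mu.
Proof.
rewrite /riesz_energy mulr_sumr; apply: eq_bigr => x _.
by rewrite mulr_sumr; apply: eq_bigr => y _; ring.
Qed.

(** The two mixed double sums coincide because the kernel is even, hence the factor 2. *)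
Lemma riesz_energyU A B mu : [disjoint A & B]%fset ->
  energy (A `|` B)%fset mu = energy A mu + energy B mu
    + 2 * \sum_(x <- A) \sum_(y <- B) g (y - x) * mu x * mu y.
Proof.
move=> AB; rewrite /riesz_energy sum_fsetU_disjoint//.
under eq_bigr do rewrite sum_fsetU_disjoint//.
under [X in _ + X]eq_bigr do rewrite sum_fsetU_disjoint//.
rewrite !big_split /= [X in _ + (X + _)]exchange_big /=.
under [X in _ + (X + _)]eq_bigr => x _ do under eq_bigr => y _ do
  rewrite -riesz_kernelN opprB mulrAC.
by ring.
Qed.

Lemma sum_translate (V : nmodType) z A (F : 'rV[int]_d -> V) :
  \sum_(x <- translate z A) F x = \sum_(x <- A) F (z + x).
Proof. by rewrite /translate big_imfset// => x y _ _ /addrI. Qed.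

Lemma riesz_energy_translate z A mu :
  energy (translate z A) mu = energy A (fun x => mu (z + x)).
Proof.
have zB x y : z + y - (z + x) = y - x by rewrite opprD addrACA subrr add0r.
rewrite /riesz_energy sum_translate; apply: eq_bigr => x _.
rewrite sum_translate; apply: eq_bigr => y _.
by rewrite zB.
Qed.

(** * Capacity as a best constant *)

(** This leaves the extended reals: the infimum is finite since a point mass is admissible, and
    nonzero since the capacity is finite. *)
Lemma minimal_energy_ex A : A != fset0 -> exists2 e, 0 < e &
  cap A = e^-1 /\ ereal_inf [set (energy A mu)%:E | mu in probability_on A] = e%:E.
Proof.
move=> /fset0Pn[a aA]; set S := [set _ | _ in _].
have delta_prob : probability_on A (fun x => (x == a)%:R : R).
  split=> [x|x|]; first exact: ler0n.
    by apply: contraNeq; rewrite pnatr_eq0 eqb0 negbK => /eqP ->.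
  rewrite (big_fsetD1 a)//= eqxx big_seq big1 ?addr0// => x.
  by rewrite !inE => /andP[/negPf ->].
have S_ge0 : (0 <= ereal_inf S)%E.
  apply: le_ereal_inf_tmp => _ [mu [mu_ge0 _ _] <-].
  by rewrite lee_fin riesz_energy_ge0.
have S_lty : (ereal_inf S < +oo)%E.
  apply: (@le_lt_trans _ _ (energy A (fun x => (x == a)%:R))%:E); last exact: ltry.
  by apply: ereal_inf_lbound; exists (fun x => (x == a)%:R).
have := @ereal_capacity_fin_num R d alpha A alpha_gt0.
rewrite /capacity /ereal_capacity -/S.
case: (ereal_inf S) S_ge0 S_lty => [e||]//; rewrite lee_fin => e_ge0 _.
(* The inverse of 0 is [+oo], so [ereal_capacity_fin_num] excludes [e = 0]. *)
rewrite inver; case: eqVneq => // e_neq0 _.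
by exists e; rewrite // lt_neqAle eq_sym e_neq0.
Qed.

Lemma capacity_ge0 A : 0 <= cap A.
Proof.
have [->|A0] := eqVneq A fset0; first by rewrite capacity0.
by have [e e_gt0 [-> _]] := minimal_energy_ex A0; rewrite invr_ge0 ltW.
Qed.

(** Both sides are quadratic in [mu], so normalizing the mass to 1 reduces the claim to the lower
    bound given by the infimum. *)
Lemma sqr_mass_le A mu : (forall x, 0 <= mu x) ->
  (\sum_(x <- A) mu x) ^+ 2 <= cap A * energy A mu.
Proof.
move=> mu_ge0; set m := \sum_(x <- A) mu x.
have [m0|m_neq0] := eqVneq m 0.
  by rewrite m0 expr0n mulr_ge0 ?capacity_ge0 ?riesz_energy_ge0.
have m_gt0 : 0 < m by rewrite lt_neqAle eq_sym m_neq0 sumr_ge0.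
have A0 : A != fset0.
  by apply: contra_neq m_neq0 => A0; rewrite /m A0 big_seq_fset0.
have [e e_gt0 [-> infE]] := minimal_energy_ex A0.
(* Outside [A] the function [mu] is arbitrary, whereas [probability_on] requires 0 there; hence the
   cutoff. *)
pose nu x := if x \in A then m^-1 * mu x else 0.
have nuE : {in A, nu =1 fun x => m^-1 * mu x} by move=> x xA; rewrite /nu xA.
have nu_prob : probability_on A nu.
  split=> [x|x xA|].
  - by rewrite /nu; case: ifP => // _; rewrite mulr_ge0// invr_ge0 ltW.
  - by rewrite /nu (negPf xA).
  - by rewrite (eq_big_seq _ nuE) -mulr_sumr mulVf.
have : (e%:E <= (energy A nu)%:E)%E.
  by rewrite -infE; apply: ereal_inf_lbound; exists nu.
rewrite lee_fin (eq_riesz_energy nuE) riesz_energyZ exprVn.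
by rewrite ler_pdivlMl ?exprn_gt0// ler_pdivlMl// [e * _]mulrC.
Qed.

(** Converse of [sqr_mass_le]: by homogeneity, mass 1 is the only case to test. *)
Lemma capacity_le A C : 0 <= C ->
  (forall mu, probability_on A mu -> 1 <= C * energy A mu) -> cap A <= C.
Proof.
move=> C_ge0 hC; have [->|A0] := eqVneq A fset0; first by rewrite capacity0.
have [e e_gt0 [-> infE]] := minimal_energy_ex A0.
have C_gt0 : 0 < C.
  rewrite lt_neqAle C_ge0 andbT; apply/negP => /eqP C0.
  (* A finite infimum provides some probability measure on [A], for which [C = 0] would give
     [1 <= 0]. *)
  have [] : exists2 t : \bar R, [set (energy A mu)%:E | mu in probability_on A] t
      & (t < +oo)%E by apply: ereal_inf_lt; rewrite infE ltry.
  by move=> _ [mu /hC + _] _; rewrite -C0 mul0r ler10.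
rewrite -[leRHS]invrK lef_pV2 ?posrE ?invr_gt0// -lee_fin -infE.
apply: le_ereal_inf_tmp => _ [mu /hC muC <-].
by rewrite lee_fin -[_^-1]mul1r ler_pdivrMr// mulrC.
Qed.

(* The equilibrium measure of [A] has both mass and energy equal to [cap A]. *)
Lemma near_equilibrium A e : 0 < e -> exists mu,
  [/\ forall x, 0 <= mu x, forall x, x \notin A -> mu x = 0,
      \sum_(x <- A) mu x = cap A & energy A mu <= cap A + e].
Proof.
move=> e_gt0; have [->|A0] := eqVneq A fset0.
  exists (fun=> 0); split=> //; first by rewrite big_seq_fset0 capacity0.
  by rewrite /riesz_energy big_seq_fset0 capacity0 add0r ltW.
have [c c_gt0 [-> infE]] := minimal_energy_ex A0.
(* Scaling a probability measure by [cap A = c^-1] divides its energy by [c ^+ 2], which turns this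
   tolerance into [e]. *)
have [] := @lb_ereal_inf_adherent _ [set (energy A mu)%:E | mu in probability_on A]
  (e * c ^+ 2); first by rewrite mulr_gt0// exprn_gt0.
  by rewrite infE.
move=> _ [mu [mu_ge0 muA mu1] <-]; rewrite infE -EFinD lte_fin => /ltW mu_e.
exists (fun x => c^-1 * mu x); split=> [x|x xA||].
- by rewrite mulr_ge0// invr_ge0 ltW.
- by rewrite muA// mulr0.
- by rewrite -mulr_sumr mu1 mulr1.
rewrite riesz_energyZ exprVn ler_pdivrMl ?exprn_gt0//.
by rewrite (le_trans mu_e)// mulrDr expr2 mulfK ?gt_eqF// [e * _]mulrC.
Qed.

(** * Translation invariance *)

Lemma capacity_translate_le z A : cap (translate z A) <= cap A.
Proof.
apply: capacity_le; first exact: capacity_ge0.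
move=> mu [mu_ge0 _ mu1]; rewrite -(expr1n _ 2) -{1}mu1 sum_translate.
by rewrite riesz_energy_translate; exact: (sqr_mass_le A (fun x => mu_ge0 (z + x))).
Qed.

Lemma translateK z A : translate (- z) (translate z A) = A.
Proof.
apply/fsetP => x; apply/imfsetP/idP => /= [[_ /imfsetP[/= a aA ->] ->]|xA].
  by rewrite addKr.
by exists (z + x); rewrite ?addKr//; apply/imfsetP; exists x.
Qed.

Lemma capacity_translate z A : cap (translate z A) = cap A.
Proof.
apply/le_anti; rewrite capacity_translate_le /=.
by rewrite -{1}(translateK z A) capacity_translate_le.
Qed.

(** * Capacity of a disjoint union *)

(** For any probability measure on the union, the mutual energy is at least [h] times the product of
    the two masses, and [sqr_mass_le] controls each self-energy; [sqr_mass_le_coupled] combines the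
    three. *)
Lemma capacityU_le A B h : [disjoint A & B]%fset -> 0 <= h ->
    h * cap A < 1 -> h * cap B < 1 ->
    (forall x y, x \in A -> y \in B -> h <= g (y - x)) ->
  cap (A `|` B)%fset <= coupled_capacity (cap A) (cap B) h.
Proof.
move=> AB h_ge0 hA hB h_le; have A_ge0 := capacity_ge0 A.
have B_ge0 := capacity_ge0 B.
apply: capacity_le => // [|mu [mu_ge0 _ mu1]]; first exact: coupled_capacity_ge0.
rewrite -(expr1n _ 2) -mu1 sum_fsetU_disjoint// riesz_energyU//.
apply: (le_trans (sqr_mass_le_coupled A_ge0 B_ge0 h_ge0 hA hB
  (riesz_energy_ge0 A mu_ge0) (riesz_energy_ge0 B mu_ge0)
  (sqr_mass_le A mu_ge0) (sqr_mass_le B mu_ge0))).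
rewrite ler_wpM2l ?coupled_capacity_ge0// lerD2l -2!mulrA ler_wpM2l//.
rewrite mulrA [h * _]mulr_sumr mulr_suml big_seq [leRHS]big_seq.
apply: ler_sum => x xA; rewrite mulr_sumr big_seq [leRHS]big_seq.
by apply: ler_sum => y yB; rewrite !ler_wpM2r// h_le.
Qed.

(** The test measure mixes near-equilibrium measures of [A] and [B] with the optimal weights
    [1 - h * q] and [1 - h * p]. Its mass is [S] and its energy at most [S * D] up to a small error,
    so the capacity is at least about [S ^+ 2 / (S * D)]. *)
Lemma capacityU_ge A B h : [disjoint A & B]%fset -> 0 <= h ->
    h * cap A < 1 -> h * cap B < 1 ->
    (forall x y, x \in A -> y \in B -> g (y - x) <= h) ->
  coupled_capacity (cap A) (cap B) h <= cap (A `|` B)%fset.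
Proof.
move=> AB h_ge0 hA hB h_ge; have A_ge0 := capacity_ge0 A.
have B_ge0 := capacity_ge0 B.
set p := cap A in hA A_ge0 *; set q := cap B in hB B_ge0 *; set c := cap _.
have c_ge0 : 0 <= c by exact: capacity_ge0.
set S := p + q - 2 * h * p * q; set D := 1 - h ^+ 2 * p * q.
have S_ge0 : 0 <= S by exact: coupled_numerator_ge0.
have D_gt0 : 0 < D by exact: coupled_denominator_gt0.
have hA' : 0 <= 1 - h * p by rewrite subr_ge0 ltW.
have hB' : 0 <= 1 - h * q by rewrite subr_ge0 ltW.
(* Weights whose squares are at most 1 do not magnify the errors of the near-equilibrium
   measures. *)
have hA1 : (1 - h * p) ^+ 2 <= 1 by rewrite expr_le1// gerBl mulr_ge0.
have hB1 : (1 - h * q) ^+ 2 <= 1 by rewrite expr_le1// gerBl mulr_ge0.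
rewrite /coupled_capacity -/S -/D ler_pdivrMr//.
have [S0|S_neq0] := eqVneq S 0; first by rewrite S0 mulr_ge0// ltW.
have S_gt0 : 0 < S by rewrite lt_neqAle eq_sym S_neq0.
suff near_le e : 0 < e -> S ^+ 2 <= c * (S * D + 2 * e).
  rewrite -(ler_pM2l S_gt0) -expr2; apply/ler_addgt0Pr => e e_gt0.
  have c1_gt0 : 0 < 2 * c + 1 by rewrite ltr_wpDl// mulr_ge0.
  (* This choice makes the error [c * (2 * e / (2 * c + 1))] at most [e]; the added 1 covers
     [c = 0]. *)
  apply: le_trans (near_le (e / (2 * c + 1)) _) _; first by rewrite divr_gt0.
  rewrite mulrDr mulrCA lerD2l mulrCA mulrA mulrCA ler_piMr//; first exact: ltW.
  by rewrite ler_pdivrMr// mul1r lerDl.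
move=> e_gt0.
have [mu [mu_ge0 muA0 muA mu_e]] := near_equilibrium A e_gt0.
have [nu [nu_ge0 nuB0 nuB nu_e]] := near_equilibrium B e_gt0.
rewrite -/p in muA mu_e; rewrite -/q in nuB nu_e.
pose eta x := (1 - h * q) * mu x + (1 - h * p) * nu x.
have etaA : {in A, eta =1 fun x => (1 - h * q) * mu x}.
  by move=> x xA; rewrite /eta nuB0 ?mulr0 ?addr0//; move/fdisjointP: AB; apply.
have etaB : {in B, eta =1 fun x => (1 - h * p) * nu x}.
  move=> x xB; rewrite /eta muA0 ?mulr0 ?add0r//.
  by move: AB; rewrite fdisjoint_sym => /fdisjointP; apply.
have eta_ge0 x : 0 <= eta x by rewrite addr_ge0// mulr_ge0.
have := sqr_mass_le (A `|` B)%fset eta_ge0.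
rewrite sum_fsetU_disjoint// riesz_energyU//.
rewrite (eq_big_seq _ etaA) (eq_big_seq _ etaB) -!mulr_sumr muA nuB.
rewrite (eq_riesz_energy etaA) (eq_riesz_energy etaB) !riesz_energyZ.
have -> : (1 - h * q) * p + (1 - h * p) * q = S by rewrite /S; ring.
move=> /le_trans; apply; rewrite ler_wpM2l//.
have cross : \sum_(x <- A) \sum_(y <- B) g (y - x) * eta x * eta y
    <= h * ((1 - h * q) * p) * ((1 - h * p) * q).
  rewrite -{1}muA -{2}nuB [_ * \sum_(x <- A) _]mulr_sumr [h * _]mulr_sumr mulr_suml
    big_seq [leRHS]big_seq.
  apply: ler_sum => x xA; rewrite !mulr_sumr big_seq [leRHS]big_seq.
  apply: ler_sum => y yB; rewrite -etaA// -etaB//.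
  by rewrite !ler_wpM2r// h_ge.
(* [S * D] is the energy of the mixture if both self-energies equal the capacities and the kernel
   between the sets is constantly [h]. *)
have -> : S * D = (1 - h * q) ^+ 2 * p + (1 - h * p) ^+ 2 * q
    + 2 * (h * ((1 - h * q) * p) * ((1 - h * p) * q)).
  by rewrite /S /D; ring.
have mu_le : (1 - h * q) ^+ 2 * energy A mu <= (1 - h * q) ^+ 2 * p + e.
  apply: le_trans (ler_wpM2l (sqr_ge0 _) mu_e) _.
  by rewrite mulrDr lerD2l ler_piMl// ltW.
have nu_le : (1 - h * p) ^+ 2 * energy B nu <= (1 - h * p) ^+ 2 * q + e.
  apply: le_trans (ler_wpM2l (sqr_ge0 _) nu_e) _.
  by rewrite mulrDr lerD2l ler_piMl// ltW.
by move: mu_le nu_le cross; lra.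
Qed.

End Capacity.

(** * Limits at infinity *)

Section Limits.
Variables (R : realType) (d : nat) (alpha : R).
Hypothesis alpha_gt0 : 0 < alpha.
Local Notation norm := (@euclidean_norm R d).
Local Notation g := (@riesz_kernel R d alpha).
Local Notation infty := (norm_infty R d).

Lemma cvg_euclidean_norm : norm z @[z --> infty] --> +oo.
Proof. by apply/cvgryPgt => M; exists M. Qed.

Lemma cvg_riesz_kernel : g z @[z --> infty] --> (0 : R).
Proof.
apply: (@cvg_trans _ (expR (- (alpha * ln (1 + norm z))) @[z --> infty])).
  apply: near_eq_cvg; near=> z.
  by rewrite /riesz_kernel /powR gt_eqF ?mulNr// ltr_pwDl// euclidean_norm_ge0.
apply: (cvg_comp _ _ _ (@cvgr_expR R)); apply/cvgryPge => M; near=> z.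
(* Solving [M <= alpha * ln (1 + norm z)] for the norm gives the threshold [expR (M / alpha)]. *)
rewrite mulrC -ler_pdivrMr// -ler_expR lnK ?posrE; last first.
  by rewrite ltr_pwDl// euclidean_norm_ge0.
rewrite ler_wpDl// ltW//; near: z.
by exists (expR (M / alpha)).
Unshelve. all: by end_near. Qed.

(** The sign of [rho] is free so that both shift estimates are covered; the base is eventually
    positive, which allows the exponential form of the power. *)
Lemma cvg_kernel_ratio (rho : R) :
  (1 + rho / (1 + norm z)) `^ (- alpha) @[z --> infty] --> (1 : R).
Proof.
have ratio1 : 1 + rho / (1 + norm z) @[z --> infty] --> (1 : R).
  rewrite -[X in _ --> X]addr0; apply: cvgD; first exact: cvg_cst.
  rewrite -(mulr0 rho); apply: cvgM; first exact: cvg_cst.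
  apply/gtr0_cvgV0; first by near=> z; rewrite ltr_pwDl// euclidean_norm_ge0.
  by apply/cvgryPge => M; exists M => // z /= /ltW ?; rewrite ler_wpDl.
apply: (@cvg_trans _ (expR (- alpha * ln (1 + rho / (1 + norm z))) @[z --> infty])).
  apply: near_eq_cvg; near=> z; rewrite /powR gt_eqF//.
  by near: z; exact: cvgr_gt ratio1 _ ltr01.
have expR1 : expR (- alpha * ln 1) = 1 :> R by rewrite ln1 mulr0 expR0.
rewrite -{3}expR1.
apply: (continuous_cvg _ (@continuous_expR R _)); apply: cvgM; first exact: cvg_cst.
exact: (continuous_cvg _ (continuous_ln ltr01)).
Unshelve. all: by end_near. Qed.

(** With [h = g z * r z], the numerator equals [h * p * q * (2 - (p + q) * h) / (1 - h ^+ 2 * p *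
    q)]. Division by [g z] leaves one factor [r z], and every other occurrence of [h] tends to 0. *)
Lemma cvg_coupled_capacity (p q : R) (r : 'rV[int]_d -> R) :
    r z @[z --> infty] --> (1 : R) ->
  (p + q - coupled_capacity p q (g z * r z)) / g z @[z --> infty] --> 2 * p * q.
Proof.
move=> r1; have gr0 : g z * r z @[z --> infty] --> (0 : R).
  by rewrite -[X in _ --> X](mul0r 1); apply: cvgM => //; exact: cvg_riesz_kernel.
have D1 : 1 - (g z * r z) ^+ 2 * p * q @[z --> infty] --> (1 : R).
  rewrite -[X in _ --> X](_ : 1 - 0 * 0 * p * q = 1); last by ring.
  apply: cvgB; first exact: cvg_cst.
  by do 2 (apply: cvgM; last exact: cvg_cst); exact: cvgM.
apply: (@cvg_trans _ (p * q * r z * (2 - (p + q) * (g z * r z))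
    / (1 - (g z * r z) ^+ 2 * p * q) @[z --> infty])).
  apply: near_eq_cvg; near=> z.
  have D_neq0 : 1 - (g z * r z) ^+ 2 * p * q != 0.
    by rewrite gt_eqF//; near: z; exact: cvgr_gt D1 _ ltr01.
  have g_neq0 : g z != 0 by rewrite gt_eqF ?riesz_kernel_gt0.
  by rewrite /coupled_capacity; field; rewrite D_neq0 g_neq0.
have -> : 2 * p * q = p * q * 1 * (2 - (p + q) * 0) / 1 by field.
apply: cvgM; last by apply: cvgV => //; exact: oner_neq0.
apply: cvgM; first by apply: cvgM => //; exact: cvg_cst.
apply: cvgB; first exact: cvg_cst.
by apply: cvgM => //; exact: cvg_cst.
Unshelve. all: by end_near. Qed.

End Limits.

(** * Squeezing the quotient *)

Theorem mainTheorem2 (R : realType) (d : nat) (alpha : R)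
    (hd : (1 <= d)%N) (halpha0 : 0 < alpha) (halphad : alpha < d%:R)
    (A B : {fset 'rV[int]_d}) :
  (capacity alpha A + capacity alpha B
     - capacity alpha (A `|` translate z B)%fset) / riesz_kernel alpha z
    @[z --> norm_infty R d]
  --> 2 * capacity alpha A * capacity alpha B.
Proof.
pose norm := @euclidean_norm R d.
(* A sum of distances bounds each of them without a maximum over possibly empty sets. *)
pose rho : R := \sum_(x <- A) \sum_(y <- B) norm (y - x).
have norm_rho x y : x \in A -> y \in B -> norm (y - x) <= rho.
  move=> xA yB; rewrite /rho (big_fsetD1 x)//= (big_fsetD1 y)//= -addrA lerDl.
  by rewrite addr_ge0 ?sumr_ge0// => *; rewrite ?sumr_ge0// => *;
    exact: euclidean_norm_ge0.
have r_ge := @cvg_kernel_ratio R d alpha rho.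
have r_le := @cvg_kernel_ratio R d alpha (- rho).
have small r p : r z @[z --> norm_infty R d] --> (1 : R) ->
    \forall z \near norm_infty R d, riesz_kernel alpha z * r z * p < 1.
  move=> r1; apply: (cvgr_lt (0 * 1 * p)); last by rewrite !mul0r.
  apply: cvgM; last exact: cvg_cst.
  by apply: cvgM => //; exact: cvg_riesz_kernel.
set p := capacity alpha A; set q := capacity alpha B.
(* The capacity of the union enters with a minus sign: its upper bound, which comes from the lower
   kernel estimate [r_ge], gives the lower side of the squeeze. *)
refine (squeeze_cvgr _ (cvg_coupled_capacity halpha0 (p := p) (q := q) r_ge)
  (cvg_coupled_capacity halpha0 (p := p) (q := q) r_le)).
near=> z.
have rho_z : rho < norm z by near: z; exists rho.
have AzB : [disjoint A & translate z B]%fset.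
  apply/fdisjointP => x xA; apply/negP => /imfsetP[/= y yB xE].
  (* A common point [x = z + y] would give [norm (y - x) = norm z], which exceeds [rho]. *)
  have := norm_rho x y xA yB; rewrite xE opprD addrC subrK.
  by rewrite /norm euclidean_normN leNgt rho_z.
have g_gt0 := riesz_kernel_gt0 alpha z.
have qE : q = capacity alpha (translate z B) by rewrite capacity_translate.
rewrite qE !ler_pM2r ?invr_gt0// !lerD2l !lerN2.
apply/andP; split.
- apply: capacityU_le => //.
  + by rewrite mulr_ge0 ?powR_ge0.
  + by near: z; exact: small.
  + by rewrite capacity_translate//; near: z; exact: small.
  move=> x _ xA /imfsetP[/= y yB ->]; rewrite -addrA.
  exact/riesz_kernelD_ge/norm_rho.
- apply: capacityU_ge => //.
  + by rewrite mulr_ge0 ?powR_ge0.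
  + by near: z; exact: small.
  + by rewrite capacity_translate//; near: z; exact: small.
  move=> x _ xA /imfsetP[/= y yB ->]; rewrite -addrA mulNr.
  apply: riesz_kernelD_le => //; first exact: norm_rho.
  by rewrite ltr_wpDl.
Unshelve. all: by end_near. Qed.
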